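(* Let $T\subset\mathbb{R}^3$ be a cube and let $k=0$. Then the weak Galerkin de Rham sequence $$\mathbb{R}^8\xrightarrow{\,I_w\,}V_k^{(1)}(T)\xrightarrow{\,\nabla_w\,}V_k^{(2)}(T)\xrightarrow{\,\nabla_w\times\,}V_k^{(3)}(T)\xrightarrow{\,\nabla_w\cdot\,}V_k^{(4)}(T)\xrightarrow{\,N\,}0$$ is exact, i.e. $\operatorname{Range}(I_w)=\operatorname{Ker}(\nabla_w)$, $\operatorname{Range}(\nabla_w)=\operatorname{Ker}(\nabla_w\times)$, $\operatorname{Range}(\nabla_w\times)=\operatorname{Ker}(\nabla_w\cdot)$, and $\operatorname{Range}(\nabla_w\cdot)=V_k^{(4)}(T)$.
   Context: Geometry and notation. $F(T)$, $E(T)$, $V(T)$ are the sets of faces, edges and vertices of $T$. $P_j(D)$ is the space of polynomials of total degree at most $j$ on $D$ (a volume, face or edge). $(\cdot,\cdot)_D$ is the $L^2$ inner product on $D$ (for the two end points $\partial e$ of an edge it is the sum of values at the end points). $\mathbf{n}$ is the unit outward normal on $\partial T$. For a face $f$, $\mathbf{n}_f$ is a fixed unit normal, $\mathbf{t}_{f,1},\mathbf{t}_{f,2}$ are orthogonal unit vectors tangential to $f$, and $\mathbf{t}_{\partial f}$ is the unit tangent on $\partial f$ oriented by the right-hand rule with respect to $\mathbf{n}_f$. For an edge $e$, $\mathbf{t}_e$ is a fixed unit tangent vector and $\mathbf{n}_{\partial e}$ is the unit outward direction (along the edge) at its two end points. Spaces. - $V_{k,0}^{(2)}(T)=V_{k,0}^{(3)}(T)=[P_k(T)]^3$,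 $V_{k,f}^{(2)}(f)=\{u_1\mathbf{t}_{f,1}+u_2\mathbf{t}_{f,2}: u_1,u_2\in P_k(f)\}$, $V_{k,e}^{(2)}(e)=\{u\mathbf{t}_e: u\in P_k(e)\}$, $V_{k,f}^{(3)}(f)=\{w_f\mathbf{n}_f: w_f\in P_k(f)\}$. - $V_k^{(1)}(T)=\{v=\{v_0,v_f,v_e,v_n\}: v_0\in P_k(T), v_f\in P_k(f), v_e\in P_k(e), v_n\in\mathbb{R}, f\in F(T), e\in E(T), n\in V(T)\}$ (one independent component for each face, edge and vertex). - $V_k^{(2)}(T)=\{\mathbf{u}=\{\mathbf{u}_0,\mathbf{u}_f,\mathbf{u}_e\}: \mathbf{u}_0\in V_{k,0}^{(2)}(T),\mathbf{u}_f\in V_{k,f}^{(2)}(f),\mathbf{u}_e\in V_{k,e}^{(2)}(e), f\in F(T), e\in E(T)\}$. - $V_k^{(3)}(T)=\{\mathbf{w}=\{\mathbf{w}_0,\mathbf{w}_f\}: \mathbf{w}_0\in V_{k,0}^{(3)}(T),\mathbf{w}_f\in V_{k,f}^{(3)}(f), f\in F(T)\}$. - $V_k^{(4)}(T)=P_k(T)$. Operators. - $I_w$ is the inclusion map $I_w(\alpha_1,\dots,\alpha_8)=\{v_0,v_f,v_e,v_n\}$ with $v_0=\alpha_1$; $v_f=\alpha_2,\alpha_3,\alpha_4$ respectively on the three pairs of parallel faces; $v_e=\alpha_5,\alpha_6,\alpha_7$ respectively on the three families of parallel edges; $v_n=\alpha_8$ at all eight vertices. - $\nabla_w v=\{\nabla_{w,0}v,\nabla_{w,f}v,\nabla_{w,e}v\}\in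 V_k^{(2)}(T)$, with $$(\nabla_{w,0}v,\varphi)_T=-(v_0,\nabla\cdot\varphi)_T+(v_f,\varphi\cdot\mathbf{n})_{\partial T}\quad\forall\varphi\in V_{k,0}^{(2)}(T),$$ $$(\nabla_{w,f}v,\theta\times\mathbf{n}_f)_f=-(v_f,(\nabla\times\theta)\cdot\mathbf{n}_f)_f+(v_e,\theta\cdot\mathbf{t}_{\partial f})_{\partial f}\quad\forall\theta\in V_{k,f}^{(2)}(f),$$ $$(\nabla_{w,e}v,\varphi\mathbf{t}_e)_e=-(v_e,\nabla\varphi\cdot\mathbf{t}_e)_e+(v_n,\varphi\,\mathbf{t}_e\cdot\mathbf{n}_{\partial e})_{\partial e}\quad\forall\varphi\mathbf{t}_e\in V_{k,e}^{(2)}(e).$$ - $\nabla_w\times\mathbf{u}=\{\nabla_{w,0}\times\mathbf{u},\nabla_{w,f}\times\mathbf{u}\}\in V_k^{(3)}(T)$, with $$(\nabla_{w,0}\times\mathbf{u},\theta)_T=(\mathbf{u}_0,\nabla\times\theta)_T+(\mathbf{u}_f,\theta\times\mathbf{n})_{\partial T}\quad\forall\theta\in V_{k,0}^{(3)}(T),$$ $$(\nabla_{w,f}\times\mathbf{u},\tau\mathbf{n}_f)_f=(\mathbf{u}_f,\nabla\tau\times\mathbf{n}_f)_f+(\mathbf{u}_e,\tau\mathbf{t}_{\partial f})_{\partial f}\quad\forall\tau\mathbf{n}_f\in V_{k,f}^{(3)}(f).$$ - $\nabla_w\cdot\mathbf{w}\in V_k^{(4)}(T)$, with $(\nabla_w\cdot\mathbf{w},\tau)_T=-(\mathbf{w}_0,\nabla\tau)_T+(\mathbf{w}_f,\tau\mathbf{n})_{\partial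 T}$ for all $\tau\in V_k^{(4)}(T)$. - $N$ is the null operator (zero map). *)

(* Defs.v *)
From HB Require Import structures.
From mathcomp Require Import all_boot all_order all_algebra.
From mathcomp Require Import boolp classical_sets reals.
From mathcomp Require Import measure lebesgue_measure lebesgue_integral.
(* The notations of multinomials clash with those of MathComp-Analysis:
   mpoly n R is the type {mpoly R[n]}, meval x p is p.@[x] and mderiv i p is
   the i-th partial derivative. *)
From mathcomp Require Import -(notations) mpoly.

Set Implicit Arguments.
Unset Strict Implicit.
Unset Printing Implicit Defensive.

Import Order.TTheory GRing.Theory Num.Theory.
Local Open Scope classical_set_scope.
Local Open Scope ring_scope.

Section Vectors.
Variable A : comNzRingType.

Definition dot (u v : 'rV[A]_3) : A := \sum_i u 0 i * v 0 i.

(* Indices are taken modulo 3. *)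
Definition cross (u v : 'rV[A]_3) : 'rV[A]_3 :=
  \row_i (u 0 (i + 1) * v 0 (i + 2) - u 0 (i + 2) * v 0 (i + 1)).

End Vectors.

(* A cube of arbitrary size, position and orientation: the points
   corner + r *: q_0 + s *: q_1 + t *: q_2 with r, s, t in [0, side], where the
   q_i are the orthonormal rows of frame. *)
Record cube (R : realType) := Cube {
  corner : 'rV[R]_3;
  frame : 'M[R]_3;
  side : R;
  side_gt0 : 0 < side;
  frame_orthonormal : frame *m frame^T = 1%:M }.

(* (i, b): the face on which the i-th cube coordinate is 0 (b = false) or side
   (b = true). *)
Definition face := ('I_3 * bool)%type.

(* (i, c): the edge parallel to q_i on which, for j : 'I_2, the cube coordinate
   of index lift i j is 0 or side according to c j. *)
Definition edge := ('I_3 * {ffun 'I_2 -> bool})%type.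

Definition vertex := {ffun 'I_3 -> bool}.

Definition edge_of_face (f : face) (e : edge) : bool :=
  if unlift e.1 f.1 is Some j then e.2 j == f.2 else false.

Definition vertex_of_edge (e : edge) (n : vertex) : bool :=
  [forall j, n (lift e.1 j) == e.2 j].

Section Cube.
Variables (R : realType) (T : cube R).
Local Notation h := (side T).
Local Notation point := 'rV[R]_3.

Definition axis (i : 'I_3) : 'rV[R]_3 := row i (frame T).

Definition coord (i : 'I_3) (x : point) : R := dot (x - corner T) (axis i).

Definition point_T (r s t : R) : point :=
  corner T + r *: axis 0 + s *: axis 1 + t *: axis 2.

Definition point_f (f : face) (s t : R) : point :=
  corner T + (f.2%:R * h) *: axis f.1
  + s *: axis (lift f.1 (0 : 'I_2)) + t *: axis (lift f.1 (1 : 'I_2)).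

Definition point_e (e : edge) (s : R) : point :=
  corner T + s *: axis e.1
  + \sum_(j < 2) ((e.2 j)%:R * h) *: axis (lift e.1 j).

Definition point_n (n : vertex) : point :=
  corner T + \sum_(i < 3) ((n i)%:R * h) *: axis i.

(* Integrals over T, a face and an edge, through the isometric
   parametrizations above. *)
Definition int_T (g : point -> R) : R :=
  \int[@lebesgue_measure R]_(r in `[0, h]) \int[@lebesgue_measure R]_(s in `[0, h])
    \int[@lebesgue_measure R]_(t in `[0, h]) g (point_T r s t).

Definition int_f (f : face) (g : point -> R) : R :=
  \int[@lebesgue_measure R]_(s in `[0, h]) \int[@lebesgue_measure R]_(t in `[0, h])
    g (point_f f s t).

Definition int_e (e : edge) (g : point -> R) : R :=
  \int[@lebesgue_measure R]_(s in `[0, h]) g (point_e e s).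

Definition sgn (b : bool) : R := if b then 1 else -1.

Definition outer_normal (f : face) : 'rV[R]_3 := sgn f.2 *: axis f.1.

(* The unit vector in the plane of f which is normal to e and points out of f.
   It is the outward normal, relative to T, of the other face containing e. *)
Definition conormal (f : face) (e : edge) : 'rV[R]_3 :=
  if unlift e.1 f.1 is Some j
  then outer_normal (lift e.1 (rev_ord j), e.2 (rev_ord j)) else 0.

(* n_{\partial e} at the end point n of e. *)
Definition end_normal (e : edge) (n : vertex) : 'rV[R]_3 :=
  sgn (n e.1) *: axis e.1.

(* The fixed unit normals and tangents of faces and edges. *)
Record directions := Directions {
  nf : face -> 'rV[R]_3;
  tf1 : face -> 'rV[R]_3;
  tf2 : face -> 'rV[R]_3;
  te : edge -> 'rV[R]_3;
  nf_unit : forall f, dot (nf f) (nf f) = 1;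
  nf_normal : forall f (j : 'I_2), dot (nf f) (axis (lift f.1 j)) = 0;
  tf1_unit : forall f, dot (tf1 f) (tf1 f) = 1;
  tf2_unit : forall f, dot (tf2 f) (tf2 f) = 1;
  tf_orthogonal : forall f, dot (tf1 f) (tf2 f) = 0;
  tf1_tangent : forall f, dot (tf1 f) (axis f.1) = 0;
  tf2_tangent : forall f, dot (tf2 f) (axis f.1) = 0;
  te_unit : forall e, dot (te e) (te e) = 1;
  te_tangent : forall e (j : 'I_2), dot (te e) (axis (lift e.1 j)) = 0 }.

(* Polynomials on T are polynomials in the Cartesian coordinates of R^3; those
   on a face or an edge are polynomials in the cube coordinates that vary along
   it. The following functions evaluate them at points of R^3. *)
Definition ev_T (p : mpoly 3 R) (x : point) : R := meval (x 0) p.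

Definition ev_f (f : face) (p : mpoly 2 R) (x : point) : R :=
  meval (fun j : 'I_2 => coord (lift f.1 j) x) p.

Definition ev_e (e : edge) (p : mpoly 1 R) (x : point) : R :=
  meval (fun _ => coord e.1 x) p.

Definition evv (n : nat) (ev : mpoly n R -> point -> R)
    (u : 'rV[mpoly n R]_3) (x : point) : 'rV[R]_3 :=
  \row_i ev (u 0 i) x.

(* The vector field p v, with p a polynomial and v a constant vector. *)
Definition pscale (n : nat) (p : mpoly n R) (v : 'rV[R]_3) :
    'rV[mpoly n R]_3 :=
  \row_i (v 0 i *: p).

(* Gradients have Cartesian components; on faces and edges they are the
   tangential gradients. *)
Definition grad_T (p : mpoly 3 R) : 'rV[mpoly 3 R]_3 := \row_i mderiv i p.

Definition grad_f (f : face) (p : mpoly 2 R) : 'rV[mpoly 2 R]_3 :=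
  \sum_(j < 2) pscale (mderiv j p) (axis (lift f.1 j)).

Definition grad_e (e : edge) (p : mpoly 1 R) : 'rV[mpoly 1 R]_3 :=
  pscale (mderiv 0 p) (axis e.1).

Definition div_T (u : 'rV[mpoly 3 R]_3) : mpoly 3 R :=
  \sum_i mderiv i (u 0 i).

(* On a face, only the component of the curl along the normal is meaningful
   (and used): it involves tangential derivatives only. *)
Definition curl (n : nat) (grad : mpoly n R -> 'rV[mpoly n R]_3)
    (u : 'rV[mpoly n R]_3) : 'rV[mpoly n R]_3 :=
  \row_i (grad (u 0 (i + 2)) 0 (i + 1) - grad (u 0 (i + 1)) 0 (i + 2)).

Definition poly_space (n k : nat) : set (mpoly n R) :=
  [set p | (msize p <= k.+1)%N].

Definition poly_vec (k : nat) : set 'rV[mpoly 3 R]_3 :=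
  [set u | forall i, poly_space k (u 0 i)].

(* Ambient additive groups of the spaces V_k^(1), ..., V_k^(4), without the
   degree and direction constraints. *)
Definition W1 : Type :=
  mpoly 3 R * {ffun face -> mpoly 2 R} * {ffun edge -> mpoly 1 R}
  * {ffun vertex -> R}.
Definition W2 : Type :=
  'rV[mpoly 3 R]_3 * {ffun face -> 'rV[mpoly 2 R]_3}
  * {ffun edge -> 'rV[mpoly 1 R]_3}.
Definition W3 : Type :=
  'rV[mpoly 3 R]_3 * {ffun face -> 'rV[mpoly 2 R]_3}.
Definition W4 : Type := mpoly 3 R.

HB.instance Definition _ := GRing.Zmodule.on W1.
HB.instance Definition _ := GRing.Zmodule.on W2.
HB.instance Definition _ := GRing.Zmodule.on W3.
HB.instance Definition _ := GRing.Zmodule.on W4.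

Definition v0 (v : W1) := v.1.1.1.
Definition vf (v : W1) := v.1.1.2.
Definition ve (v : W1) := v.1.2.
Definition vn (v : W1) := v.2.
Definition u0 (u : W2) := u.1.1.
Definition uf (u : W2) := u.1.2.
Definition ue (u : W2) := u.2.
Definition w0 (w : W3) := w.1.
Definition wf (w : W3) := w.2.

(* alpha_1 is alpha 0 0, ..., alpha_8 is alpha 0 7. *)
Definition inclusion_w (alpha : 'rV[R]_8) : W1 :=
  (mpolyC 3 (alpha 0 0),
   [ffun f : face => mpolyC 2 (alpha 0 (inord (1 + f.1)))],
   [ffun e : edge => mpolyC 1 (alpha 0 (inord (4 + e.1)))],
   [ffun n : vertex => alpha 0 (inord 7)]).

Variables (D : directions) (k : nat).

(* The unit tangent of \partial f on e, by the right-hand rule. *)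
Definition t_bd (f : face) (e : edge) : 'rV[R]_3 :=
  cross (nf D f) (conormal f e).

Definition V2_f (f : face) : set 'rV[mpoly 2 R]_3 :=
  [set u | exists u1 u2 : mpoly 2 R, [/\ poly_space k u1, poly_space k u2 &
    u = pscale u1 (tf1 D f) + pscale u2 (tf2 D f)]].

Definition V2_e (e : edge) : set 'rV[mpoly 1 R]_3 :=
  [set u | exists2 p : mpoly 1 R, poly_space k p & u = pscale p (te D e)].

Definition V3_f (f : face) : set 'rV[mpoly 2 R]_3 :=
  [set w | exists2 p : mpoly 2 R, poly_space k p & w = pscale p (nf D f)].

Definition V1 : set W1 :=
  [set v | [/\ poly_space k (v0 v), forall f, poly_space k (vf v f) &
    forall e, poly_space k (ve v e)]].

Definition V2 : set W2 :=
  [set u | [/\ poly_vec k (u0 u), forall f, V2_f f (uf u f) &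
    forall e, V2_e e (ue u e)]].

Definition V3 : set W3 :=
  [set w | poly_vec k (w0 w) /\ forall f, V3_f f (wf w f)].

Definition V4 : set W4 := [set p | poly_space k p].

Definition weak_grad_spec (v : W1) : set W2 := [set u | [/\ V2 u,
  forall phi, poly_vec k phi ->
    int_T (fun x => dot (evv ev_T (u0 u) x) (evv ev_T phi x)) =
    - int_T (fun x => ev_T (v0 v) x * ev_T (div_T phi) x)
    + \sum_f int_f f (fun x =>
        ev_f f (vf v f) x * dot (evv ev_T phi x) (outer_normal f)),
  forall f theta, V2_f f theta ->
    int_f f (fun x =>
      dot (evv (ev_f f) (uf u f) x) (cross (evv (ev_f f) theta x) (nf D f))) =
    - int_f f (fun x => ev_f f (vf v f) x *
        dot (evv (ev_f f) (curl (grad_f f) theta) x) (nf D f))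
    + \sum_(e | edge_of_face f e) int_e e (fun x =>
        ev_e e (ve v e) x * dot (evv (ev_f f) theta x) (t_bd f e)) &
  forall e (phi : mpoly 1 R), poly_space k phi ->
    int_e e (fun x => dot (evv (ev_e e) (ue u e) x) (ev_e e phi x *: te D e)) =
    - int_e e (fun x => ev_e e (ve v e) x *
        dot (evv (ev_e e) (grad_e e phi) x) (te D e))
    + \sum_(n | vertex_of_edge e n)
        vn v n * (ev_e e phi (point_n n) * dot (te D e) (end_normal e n))]].

Definition weak_curl_spec (u : W2) : set W3 := [set w | [/\ V3 w,
  forall theta, poly_vec k theta ->
    int_T (fun x => dot (evv ev_T (w0 w) x) (evv ev_T theta x)) =
    int_T (fun x => dot (evv ev_T (u0 u) x) (evv ev_T (curl grad_T theta) x))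
    + \sum_f int_f f (fun x => dot (evv (ev_f f) (uf u f) x)
        (cross (evv ev_T theta x) (outer_normal f))) &
  forall f (tau : mpoly 2 R), poly_space k tau ->
    int_f f (fun x => dot (evv (ev_f f) (wf w f) x) (ev_f f tau x *: nf D f)) =
    int_f f (fun x => dot (evv (ev_f f) (uf u f) x)
      (cross (evv (ev_f f) (grad_f f tau) x) (nf D f)))
    + \sum_(e | edge_of_face f e) int_e e (fun x =>
        dot (evv (ev_e e) (ue u e) x) (ev_f f tau x *: t_bd f e))]].

Definition weak_div_spec (w : W3) : set W4 := [set d | V4 d /\
  forall tau : W4, V4 tau ->
    int_T (fun x => ev_T d x * ev_T tau x) =
    - int_T (fun x => dot (evv ev_T (w0 w) x) (evv ev_T (grad_T tau) x))
    + \sum_f int_f f (fun x =>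
        dot (evv (ev_f f) (wf w f) x) (ev_T tau x *: outer_normal f))].

(* The defining equations have a unique solution in the polynomial space, by
   the Riesz theorem; xget picks it. *)
Definition weak_grad (v : W1) : W2 := xget 0 (weak_grad_spec v).
Definition weak_curl (u : W2) : W3 := xget 0 (weak_curl_spec u).
Definition weak_div (w : W3) : W4 := xget 0 (weak_div_spec w).

End Cube.

(* The kernel of a map L defined on the space V. *)
Definition kernel_on (A : Type) (B : zmodType) (V : set A) (L : A -> B) :
    set A :=
  [set a | V a /\ L a = 0].

Arguments V1 R k : clear implicits.
Arguments V4 R k : clear implicits.
Arguments inclusion_w R alpha : clear implicits.

(* Main.v *)
Require Import Defs.
From mathcomp Require Import all_boot all_order all_algebra.
From mathcomp Require Import boolp classical_sets reals.
From mathcomp Require Import measure lebesgue_measure lebesgue_integral.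
From mathcomp Require Import -(notations) mpoly.
From mathcomp Require Import ring lra.

(* For k = 0 all polynomials are constant, so the terms with derivatives drop
   out and the weak operators become 1/h times signed sums over the boundary. In
   the orthonormal frame of the cube these are differences of values on opposite
   faces, edges and vertices, so kernels can be read off. A preimage is found by
   summing differences along a path from a corner: edge values without
   circulation have a vertex potential; on each square whose corners are four
   parallel edges the face components have a potential, since the circulation
   around the square is a component of the volume curl. A face flux of total 0 is the
   curl of a field of edge values that vanishes in the third direction. *)

Set Implicit Arguments.
Unset Strict Implicit.
Unset Printing Implicit Defensive.

Local Open Scope classical_set_scope.

(** * Indices, dot products and cross products in dimension 3 *)

Section Vectors.
Local Open Scope ring_scope.
Import GRing.Theory.

Lemma ord3P (P : 'I_3 -> Prop) : P 0 -> P 1 -> P 2 -> forall i, P i.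
Proof.
move=> P0 P1 P2 [[|[|[|]]] // Hi].
- by have -> : Ordinal Hi = 0 by exact/val_inj.
- by have -> : Ordinal Hi = 1 by exact/val_inj.
- by have -> : Ordinal Hi = 2 by exact/val_inj.
Qed.

Lemma ord2P (P : 'I_2 -> Prop) : P 0 -> P 1 -> forall i, P i.
Proof.
move=> P0 P1 [[|[|]] // Hi].
- by have -> : Ordinal Hi = 0 by exact/val_inj.
- by have -> : Ordinal Hi = 1 by exact/val_inj.
Qed.

Lemma sum_ord3 (V : nmodType) (F : 'I_3 -> V) : \sum_i F i = F 0 + F 1 + F 2.
Proof.
rewrite !big_ord_recl big_ord0 addr0 addrA.
by congr (F _ + F _ + F _); exact/val_inj.
Qed.

Lemma lift3E : ((lift (0 : 'I_3) (0 : 'I_2) = 1) * (lift (0 : 'I_3) (1 : 'I_2) = 2)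
  * (lift (1 : 'I_3) (0 : 'I_2) = 0) * (lift (1 : 'I_3) (1 : 'I_2) = 2)
  * (lift (2 : 'I_3) (0 : 'I_2) = 0) * (lift (2 : 'I_3) (1 : 'I_2) = 1))%type.
Proof. by repeat split; apply/val_inj. Qed.

Lemma unlift3E : ((unlift (0 : 'I_3) (0 : 'I_3) = None) *
  (unlift (1 : 'I_3) (1 : 'I_3) = None) * (unlift (2 : 'I_3) (2 : 'I_3) = None) *
  (unlift (0 : 'I_3) (1 : 'I_3) = Some (0 : 'I_2)) *
  (unlift (0 : 'I_3) (2 : 'I_3) = Some (1 : 'I_2)) *
  (unlift (1 : 'I_3) (0 : 'I_3) = Some (0 : 'I_2)) *
  (unlift (1 : 'I_3) (2 : 'I_3) = Some (1 : 'I_2)) *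
  (unlift (2 : 'I_3) (0 : 'I_3) = Some (0 : 'I_2)) *
  (unlift (2 : 'I_3) (1 : 'I_3) = Some (1 : 'I_2)))%type.
Proof.
repeat split; rewrite ?unlift_none //.
(* Writing [Some j] as [unlift i (lift i j)] leaves an equation that the table of lifts decides. *)
all: match goal with |- unlift ?i _ = Some ?j => rewrite -[RHS](liftK i j) end.
all: by rewrite lift3E.
Qed.

Lemma rev_ord2E : ((rev_ord (0 : 'I_2) = 1) * (rev_ord (1 : 'I_2) = 0))%type.
Proof. by split; apply/val_inj. Qed.

Lemma row3P (A : Type) (u v : 'rV[A]_3) :
  u 0 0 = v 0 0 -> u 0 1 = v 0 1 -> u 0 2 = v 0 2 -> u = v.
Proof. by move=> h0 h1 h2; apply/rowP; apply: ord3P. Qed.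

Variable A : comNzRingType.
Implicit Types (u v w : 'rV[A]_3) (a : A).

Lemma dotE u v : dot u v = u 0 0 * v 0 0 + u 0 1 * v 0 1 + u 0 2 * v 0 2.
Proof. by rewrite /dot sum_ord3. Qed.

Lemma crossE u v :
  ((cross u v 0 0 = u 0 1 * v 0 2 - u 0 2 * v 0 1) *
   (cross u v 0 1 = u 0 2 * v 0 0 - u 0 0 * v 0 2) *
   (cross u v 0 2 = u 0 0 * v 0 1 - u 0 1 * v 0 0))%type.
Proof.
rewrite !mxE.
have e0 : (1 + 2 : 'I_3) = 0 by apply/val_inj.
have e1 : (1 + 1 : 'I_3) = 2 by apply/val_inj.
have e2 : (2 + 1 : 'I_3) = 0 by apply/val_inj.
have e3 : (2 + 2 : 'I_3) = 1 by apply/val_inj.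
by rewrite e0 e1 e2 e3 !add0r.
Qed.

Lemma dotC u v : dot u v = dot v u. Proof. by rewrite !dotE; ring. Qed.
Lemma dotDl u v w : dot (u + v) w = dot u w + dot v w.
Proof. by rewrite !dotE !mxE; ring. Qed.
Lemma dotZl a u v : dot (a *: u) v = a * dot u v.
Proof. by rewrite !dotE !mxE; ring. Qed.
Lemma dotZr a u v : dot u (a *: v) = a * dot u v.
Proof. by rewrite !dotE !mxE; ring. Qed.
Lemma dotNl u v : dot (- u) v = - dot u v.
Proof. by rewrite !dotE !mxE; ring. Qed.
Lemma dot0l u : dot 0 u = 0. Proof. by rewrite dotE !mxE; ring. Qed.
Lemma dot0r u : dot u 0 = 0. Proof. by rewrite dotE !mxE; ring. Qed.
Lemma dot_suml (I : Type) (r : seq I) (P : pred I) (F : I -> 'rV[A]_3) v :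
  dot (\sum_(i <- r | P i) F i) v = \sum_(i <- r | P i) dot (F i) v.
Proof.
elim/big_rec2: _ => [|i x y _ <-]; first exact: dot0l.
exact: dotDl.
Qed.
Lemma dot_inj u v : (forall w, dot u w = dot v w) -> u = v.
Proof.
move=> uv; apply/rowP => i; move: (uv (delta_mx 0 i)).
by elim/ord3P: i; rewrite !dotE !mxE /= !mulr0 !mulr1 ?addr0 ?add0r.
Qed.

Lemma dot_cross_perm u v w : dot u (cross v w) = dot v (cross w u).
Proof. by rewrite !dotE !crossE; ring. Qed.
Lemma crossZl a u v : cross (a *: u) v = a *: cross u v.
Proof. by apply: row3P; rewrite !(crossE, mxE); ring. Qed.
Lemma cross_crossl u v w : cross (cross u v) w = dot u w *: v - dot v w *: u.
Proof. by apply: row3P; rewrite !(crossE, dotE, mxE); ring. Qed.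
End Vectors.

(** * Orthonormal frames and the orientation of the cube *)

Section Frames.
Local Open Scope ring_scope.
Import GRing.Theory.
Variables (R : realType).
Implicit Types (u v w : 'rV[R]_3) (a : R).

(** The matrix M with rows u, v, w satisfies M M^T = 1, hence also M^T M = 1, and x = (x M^T) M is
    the expansion. An arbitrary triple is allowed because the fixed tangents of a face, completed by
    its axis, form such a frame too. *)
Lemma orthonormal_expansion u v w x :
  dot u u = 1 -> dot v v = 1 -> dot w w = 1 ->
  dot u v = 0 -> dot u w = 0 -> dot v w = 0 ->
  x = dot x u *: u + dot x v *: v + dot x w *: w.
Proof.
move=> uu vv ww uv uw vw.
pose M : 'M[R]_3 := \matrix_(i < 3) nth 0 [:: u; v; w] i.
have M0 j : M 0 j = u 0 j by rewrite mxE.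
have M1 j : M 1 j = v 0 j by rewrite mxE.
have M2 j : M 2 j = w 0 j by rewrite mxE.
have MM : M *m M^T = 1%:M.
  apply/matrixP => i j; rewrite !mxE sum_ord3 ![M^T _ _]mxE.
  elim/ord3P: i; elim/ord3P: j; rewrite ?M0 ?M1 ?M2 -?dotE //=.
  1-3: by rewrite dotC.
have MM' := mulmx1C MM.
rewrite -[LHS]mulmx1 -MM' mulmxA; apply/rowP => j.
rewrite ![in LHS]mxE sum_ord3 ![in LHS]mxE !sum_ord3 ![M^T _ _]mxE.
by rewrite !M0 !M1 !M2 -!dotE !mxE.
Qed.

Variable T : cube R.
Local Notation q := (axis T).

Lemma dot_axis i j : dot (q i) (q j) = (i == j)%:R.
Proof.
have /matrixP/(_ i j) := frame_orthonormal T.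
rewrite !mxE => <-; rewrite /dot; apply: eq_bigr => l _.
by rewrite !mxE.
Qed.

Lemma axis_expansion x :
  x = dot x (q 0) *: q 0 + dot x (q 1) *: q 1 + dot x (q 2) *: q 2.
Proof. by apply: orthonormal_expansion; rewrite dot_axis. Qed.

Lemma axis_inj x y : (forall i, dot x (q i) = dot y (q i)) -> x = y.
Proof. by move=> xy; rewrite (axis_expansion x) (axis_expansion y) !xy. Qed.

Lemma axis_parallel (i : 'I_3) x : (forall j : 'I_2, dot x (q (lift i j)) = 0) ->
  x = dot x (q i) *: q i.
Proof.
move=> h; apply: axis_inj => j; rewrite dotZl dot_axis.
case: (unliftP i j) => [j' ->|->]; last by rewrite eqxx mulr1.
by rewrite h (negbTE (neq_lift _ _)) mulr0.
Qed.

(* The frame may be left-handed, in which case this is -1. *)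
Definition orientation := dot (q 0) (cross (q 1) (q 2)).
Local Notation s := orientation.

(** By Lagrange's identity q_1 x q_2 is a unit vector. It is orthogonal to q_1 and q_2, so its
    expansion in the frame is s q_0, whose squared length is s^2. *)
Lemma orientation_sqr : s * s = 1.
Proof.
have : dot (cross (q 1) (q 2)) (cross (q 1) (q 2)) = 1.
  transitivity (dot (q 1) (q 1) * dot (q 2) (q 2) - dot (q 1) (q 2) * dot (q 1) (q 2)).
    by rewrite !dotE !crossE; ring.
  by rewrite !dot_axis /=; ring.
rewrite {1}(axis_expansion (cross (q 1) (q 2))).
have -> : dot (cross (q 1) (q 2)) (q 1) = 0 by rewrite !dotE !crossE; ring.
have -> : dot (cross (q 1) (q 2)) (q 2) = 0 by rewrite !dotE !crossE; ring.
by rewrite !scale0r !addr0 dotZl [dot (cross _ _) _]dotC.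
Qed.

Lemma cross_axis :
  ((cross (q 0) (q 1) = s *: q 2) * (cross (q 1) (q 2) = s *: q 0) *
   (cross (q 2) (q 0) = s *: q 1))%type.
Proof.
do !split; apply: axis_inj; elim/ord3P; rewrite dotZl dot_axis /= ?mulr0 ?mulr1 /s.
all: by rewrite !dotE !crossE; ring.
Qed.

End Frames.

(** * Degree 0: integrals of constants and normal forms of the elements of the spaces *)

Section ConstantFields.
Local Open Scope ring_scope.
Import Order.TTheory GRing.Theory Num.Theory.
Variables (R : realType) (T : cube R) (D : directions T).
Local Notation h := (side T).
Local Notation q := (axis T).

Lemma Rintegral_side (g : R -> R) (c : R) : (forall s, g s = c) ->
  (\int[@lebesgue_measure R]_(s in `[0, h]) g s = h * c)%R.
Proof.
move=> gc; have -> : g = (fun=> c) by apply/funext.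
rewrite Rintegral_cst //= lebesgue_measure_itv /=.
by rewrite constructive_ereal.lte_fin side_gt0 /= subr0 mulrC.
Qed.

Lemma int_T_cst (g : 'rV[R]_3 -> R) c :
  (forall x, g x = c) -> int_T T g = h ^+ 3 * c.
Proof.
move=> gc; rewrite /int_T -mulrA -mulrA.
by do 3!apply: Rintegral_side => ?.
Qed.

Lemma int_f_cst f (g : 'rV[R]_3 -> R) c :
  (forall x, g x = c) -> int_f T f g = h ^+ 2 * c.
Proof.
move=> gc; rewrite /int_f -mulrA.
by do 2!apply: Rintegral_side => ?.
Qed.

Lemma int_e_cst e (g : 'rV[R]_3 -> R) c :
  (forall x, g x = c) -> int_e T e g = h * c.
Proof. by move=> gc; rewrite /int_e; apply: Rintegral_side => ?. Qed.

Lemma poly_space0P n (p : mpoly n R) : poly_space 0 p <-> exists c, p = mpolyC n c.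
Proof.
split=> [/msize1_polyC ->|[c ->]]; first by eexists.
by rewrite /poly_space /= msizeC leq_b1.
Qed.

Definition cvec n (v : 'rV[R]_3) : 'rV[mpoly n R]_3 := map_mx (@mpolyC n R) v.

Lemma cvec_inj n : injective (cvec n).
Proof. exact: map_mx_inj. Qed.

Lemma pscale_cvec n c v : pscale (mpolyC n c) v = cvec n (c *: v).
Proof. by apply/rowP => i; rewrite !mxE -mul_mpolyC -mpolyCM mulrC. Qed.

Lemma poly_vec0P (u : 'rV[mpoly 3 R]_3) : poly_vec 0 u <-> exists v, u = cvec 3 v.
Proof.
split=> [u0|[v -> i]]; last by apply/poly_space0P; exists (v 0 i); rewrite mxE.
have /choice[v vP] : forall i, exists c, u 0 i = mpolyC 3 c.
  by move=> i; apply/poly_space0P.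
by exists (\row_i v i); apply/rowP => i; rewrite !mxE.
Qed.

Lemma ev_T_cst c x : ev_T (mpolyC 3 c) x = c :> R.
Proof. exact: mevalC. Qed.
Lemma ev_f_cst f c x : ev_f T f (mpolyC 2 c) x = c.
Proof. exact: mevalC. Qed.
Lemma ev_e_cst e c x : ev_e T e (mpolyC 1 c) x = c.
Proof. exact: mevalC. Qed.
Lemma evv_T_cst v x : evv (@ev_T R) (cvec 3 v) x = v.
Proof. by apply/rowP => i; rewrite !mxE ev_T_cst. Qed.
Lemma evv_f_cst f v x : evv (ev_f T f) (cvec 2 v) x = v.
Proof. by apply/rowP => i; rewrite !mxE ev_f_cst. Qed.
Lemma evv_e_cst e v x : evv (ev_e T e) (cvec 1 v) x = v.
Proof. by apply/rowP => i; rewrite !mxE ev_e_cst. Qed.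

Lemma cvec0 n : cvec n 0 = 0.
Proof. exact: map_mx0. Qed.

Lemma pscale0 n v : pscale (0 : mpoly n R) v = 0.
Proof. by apply/rowP => i; rewrite !mxE scaler0. Qed.
Lemma grad_T_cst c : grad_T (mpolyC 3 c) = 0 :> 'rV[mpoly 3 R]_3.
Proof. by apply/rowP => i; rewrite !mxE mderivC. Qed.
Lemma grad_f_cst f c : grad_f T f (mpolyC 2 c) = 0.
Proof. by rewrite /grad_f big1 // => j _; rewrite mderivC pscale0. Qed.
Lemma grad_e_cst e c : grad_e T e (mpolyC 1 c) = 0.
Proof. by rewrite /grad_e mderivC pscale0. Qed.
Lemma div_T_cst v : div_T (cvec 3 v) = 0.
Proof. by rewrite /div_T big1 // => j _; rewrite mxE mderivC. Qed.
Lemma curl_cst n (grad : mpoly n R -> 'rV[mpoly n R]_3) v :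
  (forall c, grad (mpolyC n c) = 0) -> curl grad (cvec n v) = 0.
Proof. by move=> g0; apply/rowP => i; rewrite !mxE !g0 !mxE subr0. Qed.

(** Normal forms: real numbers and vectors of R^3 are lifted to constant polynomials. The tangency
    of face and edge values is not built in; it is imposed where [mk2] and [mk3] are used. *)
Definition mk1 (c : R) (p : face -> R) (x : edge -> R) (r : vertex -> R) : W1 R :=
  (mpolyC 3 c, [ffun f => mpolyC 2 (p f)], [ffun e => mpolyC 1 (x e)], [ffun n => r n]).
Definition mk2 (a : 'rV[R]_3) (b : face -> 'rV[R]_3) (x : edge -> 'rV[R]_3) : W2 R :=
  (cvec 3 a, [ffun f => cvec 2 (b f)], [ffun e => cvec 1 (x e)]).
Definition mk3 (a : 'rV[R]_3) (b : face -> 'rV[R]_3) : W3 R :=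
  (cvec 3 a, [ffun f => cvec 2 (b f)]).

Lemma mk2_inj a b x a' b' x' : mk2 a b x = mk2 a' b' x' ->
  [/\ a = a', forall f, b f = b' f & forall e, x e = x' e].
Proof.
move=> [/cvec_inj aa /ffunP bb /ffunP xx]; split=> // [f|e].
  by move: (bb f); rewrite !ffunE => /cvec_inj.
by move: (xx e); rewrite !ffunE => /cvec_inj.
Qed.

Lemma mk3_inj a b a' b' : mk3 a b = mk3 a' b' -> a = a' /\ forall f, b f = b' f.
Proof.
move=> [/cvec_inj aa /ffunP bb]; split=> // f.
by move: (bb f); rewrite !ffunE => /cvec_inj.
Qed.

Lemma mk2_0 : mk2 0 (fun=> 0) (fun=> 0) = 0.
Proof.
by rewrite /mk2 cvec0; congr (_, _, _); apply/ffunP => ?; rewrite !ffunE cvec0.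
Qed.

Lemma mk3_0 : mk3 0 (fun=> 0) = 0.
Proof. by rewrite /mk3 cvec0; congr (_, _); apply/ffunP => ?; rewrite !ffunE cvec0. Qed.

Lemma V1P v : V1 R 0 v <-> exists c p x r, v = mk1 c p x r.
Proof.
split=> [|[c [p [x [r ->]]]]].
  case: v => [[[v f] e] n]; rewrite /V1 /v0 /vf /ve /= => -[/poly_space0P[c ->]].
  move=> F E; have /choice[p pf] i := (poly_space0P _).1 (F i).
  have /choice[x xe] i := (poly_space0P _).1 (E i).
  exists c, p, x, n; congr (_, _, _, _); apply/ffunP => ?; rewrite !ffunE //.
split=> [|f|e]; apply/poly_space0P; rewrite /= ?ffunE; by eexists.
Qed.

Lemma nf_axis f : nf D f = dot (nf D f) (q f.1) *: q f.1.
Proof. exact/axis_parallel/nf_normal. Qed.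
Lemma te_axis e : te D e = dot (te D e) (q e.1) *: q e.1.
Proof. exact/axis_parallel/te_tangent. Qed.

Lemma nf_sign f : dot (nf D f) (q f.1) * dot (nf D f) (q f.1) = 1.
Proof.
by have := nf_unit D f; rewrite {1 2}(nf_axis f) dotZl dotZr dot_axis eqxx mulr1.
Qed.
Lemma te_sign e : dot (te D e) (q e.1) * dot (te D e) (q e.1) = 1.
Proof.
by have := te_unit D e; rewrite {1 2}(te_axis e) dotZl dotZr dot_axis eqxx mulr1.
Qed.

Lemma V2_fP f u : V2_f D 0 f u <-> exists2 b, dot b (q f.1) = 0 & u = cvec 2 b.
Proof.
split=> [[u1 [u2 [/poly_space0P[a ->] /poly_space0P[b ->] ->]]]|[b b0 ->]].
  exists (a *: tf1 D f + b *: tf2 D f); last by rewrite !pscale_cvec /cvec map_mxD.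
  by rewrite dotDl !dotZl tf1_tangent tf2_tangent !mulr0 addr0.
(* These are the coefficients of b in the frame made of the two tangents and the axis of f; the
   third coefficient is 0 because b is tangential. *)
exists (mpolyC 2 (dot b (tf1 D f))), (mpolyC 2 (dot b (tf2 D f))).
split; [by apply/poly_space0P; eexists..|].
rewrite !pscale_cvec /cvec -map_mxD; congr map_mx.
rewrite {1}(@orthonormal_expansion _ (tf1 D f) (tf2 D f) (q f.1) b).
- by rewrite b0 scale0r addr0.
- exact: tf1_unit.
- exact: tf2_unit.
- by rewrite dot_axis eqxx.
- exact: tf_orthogonal.
- exact: tf1_tangent.
- exact: tf2_tangent.
Qed.

Lemma V2_eP e u : V2_e D 0 e u <-> exists x, u = cvec 1 (x *: q e.1).
Proof.
split=> [[_ /poly_space0P[a ->] ->]|[x ->]].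
  by rewrite pscale_cvec te_axis scalerA; eexists.
(* The fixed tangent is plus or minus the axis, so multiplying by this sign once more recovers x. *)
exists (mpolyC 1 (x * dot (te D e) (q e.1))); first by apply/poly_space0P; eexists.
by rewrite pscale_cvec te_axis scalerA -mulrA -te_axis te_sign mulr1.
Qed.

Lemma V3_fP f u : V3_f D 0 f u <-> exists x, u = cvec 2 (x *: q f.1).
Proof.
split=> [[_ /poly_space0P[a ->] ->]|[x ->]].
  by rewrite pscale_cvec nf_axis scalerA; eexists.
exists (mpolyC 2 (x * dot (nf D f) (q f.1))); first by apply/poly_space0P; eexists.
by rewrite pscale_cvec nf_axis scalerA -mulrA -nf_axis nf_sign mulr1.
Qed.

Lemma V2P u : V2 D 0 u <-> exists a b x, [/\ u = mk2 a b (fun e => x e *: q e.1) &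
  forall f, dot (b f) (q f.1) = 0].
Proof.
split=> [|[a [b [x [-> b0]]]]].
  case: u => [[a b] x]; rewrite /V2 /u0 /uf /ue /= => -[/poly_vec0P[a' ->]].
  move=> F E; have /choice[x' xe] i := (V2_eP _ _).1 (E i).
  have /choice[b' be] : forall f, exists v, dot v (q f.1) = 0 /\ b f = cvec 2 v.
    by move=> f; have /V2_fP[v] := F f; exists v.
  exists a', b', x'; split=> [|f]; last by have [] := be f.
  by congr (_, _, _); apply/ffunP => i; rewrite !ffunE //; have [] := be i.
split=> [|f|e].
- by apply/poly_vec0P; eexists.
- by apply/V2_fP; exists (b f) => //; rewrite /uf/= ffunE.
- by apply/V2_eP; exists (x e); rewrite /ue/= ffunE.
Qed.

Lemma V3P w : V3 D 0 w <-> exists a y, w = mk3 a (fun f => y f *: q f.1).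
Proof.
split=> [|[a [y ->]]].
  case: w => [a y]; rewrite /V3 /w0 /wf /= => -[/poly_vec0P[a' ->]].
  move=> F; have /choice[y' ye] i := (V3_fP _ _).1 (F i).
  by exists a', y'; congr (_, _); apply/ffunP => i; rewrite !ffunE.
split=> [|f].
- by apply/poly_vec0P; eexists.
- by apply/V3_fP; exists (y f); rewrite /wf/= ffunE.
Qed.
End ConstantFields.

Lemma forall_iff (I : Type) (P Q : I -> Prop) : (forall i, P i <-> Q i) ->
  (forall i, P i) <-> (forall i, Q i).
Proof. by move=> PQ; split=> H i; apply/PQ. Qed.

Lemma eqr_iff (I : Type) (a b c : I) : b = c -> (a = b) <-> (a = c).
Proof. by move=> ->. Qed.

(** * Closed formulas for the weak operators *)

Section WeakOperators.
Local Open Scope ring_scope.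
Import Order.TTheory GRing.Theory Num.Theory.
Variables (R : realType) (T : cube R) (D : directions T).
Local Notation h := (side T).
Local Notation q := (axis T).

Lemma forall_poly_vec0 (P : 'rV[mpoly 3 R]_3 -> Prop) Q :
  (forall w, P (cvec 3 w) <-> Q w) ->
  (forall phi, poly_vec 0 phi -> P phi) <-> forall w, Q w.
Proof.
move=> PQ; split=> [H w|H _ /poly_vec0P[w ->]]; last exact/PQ.
by apply/PQ/H/poly_vec0P; eexists.
Qed.

Lemma forall_poly_space0 n (P : mpoly n R -> Prop) Q :
  (forall c, P (mpolyC n c) <-> Q c) ->
  (forall phi, poly_space 0 phi -> P phi) <-> forall c, Q c.
Proof.
move=> PQ; split=> [H c|H _ /poly_space0P[c ->]]; last exact/PQ.
by apply/PQ/H/poly_space0P; eexists.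
Qed.

Lemma forall_V2_f f (P : 'rV[mpoly 2 R]_3 -> Prop) Q :
  (forall w, P (cvec 2 w) <-> Q w) ->
  (forall phi, V2_f D 0 f phi -> P phi) <-> forall w, dot w (q f.1) = 0 -> Q w.
Proof.
move=> PQ; split=> [H w w0|H _ /V2_fP[w w0 ->]]; last by apply/PQ; apply: H.
by apply/PQ/H/V2_fP; exists w.
Qed.

Lemma side_neq0 : h != 0. Proof. by rewrite gt_eqF // side_gt0. Qed.

(** The conormal lies along the axis that is parallel neither to e nor to the normal of f. *)
Lemma conormal_tangent f e : dot (conormal T f e) (q f.1) = 0.
Proof.
rewrite /conormal; case: unliftP => [j fE|_]; last exact: dot0l.
rewrite /outer_normal dotZl dot_axis /= fE (inj_eq lift_inj).
by elim/ord2P: j {fE}; rewrite rev_ord2E mulr0.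
Qed.

Lemma scale_sideP (k : nat) (a b : R) : h ^+ k.+1 * a = h ^+ k * b <-> a = h^-1 * b.
Proof.
rewrite exprSr -mulrA; split=> [/(mulfI (expf_neq0 _ side_neq0)) <-|->].
  by rewrite mulKf // side_neq0.
by rewrite mulVKf // side_neq0.
Qed.

(** Here s is the sign of a fixed normal or tangent relative to its axis. Testing with c = s removes
    it, so the resulting formula does not depend on the chosen directions. *)
Lemma scale_side_testP (k : nat) (s a b : R) : s * s = 1 ->
  (forall c, h ^+ k.+1 * (a * (c * s)) = h ^+ k * (b * (c * s))) <-> a = h^-1 * b.
Proof.
move=> s1; split=> [ab|-> c]; last by apply/scale_sideP; rewrite -mulrA.
by have := ab s; rewrite s1 !mulr1 => /scale_sideP.
Qed.

Lemma scale_side_rowP (k : nat) (a b : 'rV[R]_3) :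
  (forall w, h ^+ k.+1 * dot a w = h ^+ k * dot b w) <-> a = h^-1 *: b.
Proof.
split=> [ab|-> w]; last by apply/scale_sideP; rewrite dotZl.
by apply: dot_inj => w; have /scale_sideP-> := ab w; rewrite dotZl.
Qed.

(** The vectors w x n_f with w tangential exhaust the tangential directions: for an axis q_i in the
    plane of f, the choice w = n_f x q_i gives q_i. Thus all tangential components of a are
    determined, and the normal ones vanish on both sides. *)
Lemma scale_side_tangentP (k : nat) f (a b : 'rV[R]_3) :
  dot a (q f.1) = 0 -> dot b (q f.1) = 0 ->
  (forall w, dot w (q f.1) = 0 ->
    h ^+ k.+1 * dot a (cross w (nf D f)) = h ^+ k * dot b (cross w (nf D f))) <->
  a = h^-1 *: b.
Proof.
move=> a0 b0; split=> [ab|-> w _]; last by apply/scale_sideP; rewrite dotZl.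
apply: (@axis_inj _ T) => i; rewrite dotZl.
have [->|ni] := eqVneq i f.1; first by rewrite a0 b0 mulr0.
have nf_i : dot (q i) (nf D f) = 0.
  by rewrite nf_axis dotZr dot_axis (negbTE ni) mulr0.
have -> : q i = cross (cross (nf D f) (q i)) (nf D f).
  by rewrite cross_crossl nf_i nf_unit scale1r scale0r subr0.
apply/(scale_sideP k)/ab.
by rewrite nf_axis crossZl dotZl [X in _ * X]dotE !crossE; ring.
Qed.

(** Constant test functions kill the terms with derivatives, and the remaining integrands are
    constant, so every integral is a power of h times a value. The left side carries one power more
    than the boundary terms, whence the factor 1/h. *)
Lemma weak_grad_specP c p x r a b y : (forall f, dot (b f) (q f.1) = 0) ->
  weak_grad_spec D 0 (mk1 c p x r) (mk2 a b (fun e => y e *: q e.1)) <->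
  [/\ a = h^-1 *: \sum_f p f *: outer_normal T f,
    forall f, b f = h^-1 *: \sum_(e | edge_of_face f e) x e *: conormal T f e &
    forall e, y e = h^-1 * \sum_(n | vertex_of_edge e n) r n * sgn R (n e.1)].
Proof.
move=> b0.
have iff4 (P1 P2 P3 P4 Q2 Q3 Q4 : Prop) : P1 -> (P2 <-> Q2) -> (P3 <-> Q3) ->
  (P4 <-> Q4) -> [/\ P1, P2, P3 & P4] <-> [/\ Q2, Q3 & Q4].
  by move=> ? [? ?] [? ?] [? ?]; split=> -[*]; split; auto.
apply: iff4.
- by apply/V2P; do 3!eexists.
- rewrite -(scale_side_rowP 2); apply: forall_poly_vec0 => w.
  rewrite (@int_T_cst _ _ _ (dot a w)); last by move=> z; rewrite !evv_T_cst.
  rewrite (@int_T_cst _ _ _ 0); last first.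
    by move=> z; rewrite div_T_cst -(mpolyC0 3 R) !ev_T_cst mulr0.
  rewrite mulr0 oppr0 add0r; apply: eqr_iff; rewrite dot_suml mulr_sumr.
  apply: eq_bigr => f _; apply: int_f_cst => z.
  by rewrite /vf ffunE evv_T_cst ev_f_cst dotZl [dot w _]dotC.
- apply: forall_iff => f.
  have S0 : dot (\sum_(e | edge_of_face f e) x e *: conormal T f e) (q f.1) = 0.
    by rewrite dot_suml big1 // => e _; rewrite dotZl conormal_tangent mulr0.
  rewrite -(scale_side_tangentP 1 (b0 f) S0); apply: forall_V2_f => w.
  rewrite (@int_f_cst _ _ _ _ (dot (b f) (cross w (nf D f)))); last first.
    by move=> z; rewrite /uf/= ffunE !evv_f_cst.
  rewrite (@int_f_cst _ _ _ _ 0); last first.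
    move=> z; rewrite curl_cst; last exact: grad_f_cst.
    by rewrite -(cvec0 R 2) evv_f_cst dot0l mulr0.
  rewrite mulr0 oppr0 add0r expr1; apply: eqr_iff; rewrite dot_suml mulr_sumr.
  apply: eq_bigr => e _; apply: int_e_cst => z.
  (* Cyclic permutation turns w . (n_f x m), with m the conormal, into m . (w x n_f), the test
     expression of the left side. *)
  by rewrite /ve/= ffunE evv_f_cst ev_e_cst dotZl /t_bd 2!dot_cross_perm.
- apply: forall_iff => e.
  rewrite -(scale_side_testP 0 _ _ (te_sign D e)); apply: forall_poly_space0 => d.
  rewrite (@int_e_cst _ _ _ _ (y e * (d * dot (te D e) (q e.1)))); last first.
    by move=> z; rewrite /ue/= ffunE evv_e_cst ev_e_cst dotZl dotZr [dot (q _) _]dotC.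
  rewrite (@int_e_cst _ _ _ _ 0); last first.
    by move=> z; rewrite grad_e_cst -(cvec0 R 1) evv_e_cst dot0l mulr0.
  rewrite mulr0 oppr0 add0r expr1; apply: eqr_iff; rewrite mulr_suml mulr_sumr.
  by apply: eq_bigr => n _; rewrite /vn ffunE ev_e_cst /end_normal dotZr; ring.
Qed.

Lemma weak_curl_specP a b x a' y :
  weak_curl_spec D 0 (mk2 a b (fun e => x e *: q e.1)) (mk3 a' (fun f => y f *: q f.1)) <->
  a' = h^-1 *: (\sum_f cross (outer_normal T f) (b f)) /\
  forall f, y f = h^-1 * \sum_(e | edge_of_face f e)
    x e * dot (q e.1) (cross (q f.1) (conormal T f e)).
Proof.
have iff3 (P1 P2 P3 Q2 Q3 : Prop) : P1 -> (P2 <-> Q2) -> (P3 <-> Q3) ->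
  [/\ P1, P2 & P3] <-> Q2 /\ Q3.
  by move=> ? [? ?] [? ?]; split=> -[*]; split; auto.
apply: iff3.
- by apply/V3P; do 2!eexists.
- rewrite -(scale_side_rowP 2); apply: forall_poly_vec0 => w.
  rewrite (@int_T_cst _ _ _ (dot a' w)); last by move=> z; rewrite !evv_T_cst.
  rewrite (@int_T_cst _ _ _ 0); last first.
    move=> z; rewrite curl_cst; last exact: grad_T_cst.
    by rewrite -(cvec0 R 3) !evv_T_cst dot0r.
  rewrite mulr0 add0r; apply: eqr_iff; rewrite dot_suml mulr_sumr.
  apply: eq_bigr => f _; apply: int_f_cst => z.
  by rewrite /uf/= ffunE evv_T_cst evv_f_cst dot_cross_perm dotC.
- apply: forall_iff => f.
  rewrite -(scale_side_testP 1 _ _ (nf_sign D f)); apply: forall_poly_space0 => d.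
  rewrite (@int_f_cst _ _ _ _ (y f * (d * dot (nf D f) (q f.1)))); last first.
    by move=> z; rewrite /wf/= ffunE evv_f_cst ev_f_cst dotZl dotZr [dot (q _) _]dotC.
  rewrite (@int_f_cst _ _ _ _ 0); last first.
    move=> z; rewrite grad_f_cst -(cvec0 R 2) evv_f_cst.
    by rewrite dotE !crossE !mxE; ring.
  rewrite mulr0 add0r expr1; apply: eqr_iff; rewrite mulr_suml mulr_sumr.
  apply: eq_bigr => e _; apply: int_e_cst => z.
  (* The sign of n_f enters both the test field and the tangent of the boundary, so it occurs as a
     common factor and the axis of f can replace n_f in the formula. *)
  rewrite /ue/= ffunE evv_e_cst ev_f_cst /t_bd.
  by rewrite {1}nf_axis crossZl !dotZl !dotZr; ring.
Qed.

Lemma weak_div_specP a y d :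
  weak_div_spec T 0 (mk3 a (fun f => y f *: q f.1)) (mpolyC 3 d) <->
  d = h^-1 * \sum_f y f * sgn R f.2.
Proof.
have iff2 (P1 P2 Q : Prop) : P1 -> (P2 <-> Q) -> P1 /\ P2 <-> Q by tauto.
apply: iff2; first by apply/poly_space0P; eexists.
rewrite -(scale_side_testP 2 _ _ (mulr1 1)); apply: forall_poly_space0 => c.
rewrite mulr1 (@int_T_cst _ _ _ (d * c)); last by move=> z; rewrite !ev_T_cst.
rewrite (@int_T_cst _ _ _ 0); last first.
  by move=> z; rewrite grad_T_cst -(cvec0 R 3) !evv_T_cst dot0r.
rewrite mulr0 oppr0 add0r; apply: eqr_iff; rewrite mulr_suml mulr_sumr.
apply: eq_bigr => f _; apply: int_f_cst => z.
rewrite /wf/= ffunE evv_f_cst ev_T_cst /outer_normal.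
by rewrite dotZl !dotZr dot_axis eqxx mulr1 [c * _]mulrC mulrA.
Qed.

(** The equivalence [weak_grad_specP] yields existence and uniqueness together: any solution lies in
    [V2], hence has the normal form to which the equivalence applies. The curl and the divergence
    are treated alike. *)
Lemma weak_gradE c p x r : weak_grad D 0 (mk1 c p x r) =
  mk2 (h^-1 *: \sum_f p f *: outer_normal T f)
    (fun f => h^-1 *: \sum_(e | edge_of_face f e) x e *: conormal T f e)
    (fun e => (h^-1 * \sum_(n | vertex_of_edge e n) r n * sgn R (n e.1)) *: q e.1).
Proof.
apply: xget_unique => [|u Hu].
  apply/weak_grad_specP => // f.
  rewrite dotZl dot_suml big1 ?mulr0 // => e _.
  by rewrite dotZl conormal_tangent mulr0.
have [/V2P[a [b [y [uE b0]]]] _ _ _] := Hu.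
move: Hu; rewrite uE => /(weak_grad_specP _ _ _ _ _ _ b0)[-> bE yE].
by congr (mk2 _ _ _); apply/funext => i; rewrite ?bE ?yE.
Qed.

Lemma weak_curlE a b x : weak_curl D 0 (mk2 a b (fun e => x e *: q e.1)) =
  mk3 (h^-1 *: (\sum_f cross (outer_normal T f) (b f)))
    (fun f => (h^-1 * \sum_(e | edge_of_face f e)
       x e * dot (q e.1) (cross (q f.1) (conormal T f e))) *: q f.1).
Proof.
apply: xget_unique => [|w Hw]; first exact/weak_curl_specP.
have [/V3P[a' [y wE]] _ _] := Hw.
move: Hw; rewrite wE => /weak_curl_specP[-> yE].
by congr (mk3 _ _); apply/funext => f; rewrite yE.
Qed.

Lemma weak_divE a y : weak_div T 0 (mk3 a (fun f => y f *: q f.1)) =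
  mpolyC 3 (h^-1 * \sum_f y f * sgn R f.2).
Proof.
apply: xget_unique => [|d Hd]; first exact/weak_div_specP.
have [/poly_space0P[c dE] _] := Hd.
by move: Hd; rewrite dE => /weak_div_specP ->.
Qed.

End WeakOperators.

(** * Boundary sums as differences of values on opposite faces, edges and vertices *)

Section Enumeration.
Local Open Scope ring_scope.
Import Order.TTheory GRing.Theory Num.Theory.

(** As [lift] is increasing, b is the position in the smaller of the two remaining coordinates and c
    the position in the larger one. *)
Definition edge3 (i : 'I_3) (b c : bool) : edge :=
  (i, [ffun j : 'I_2 => if j == 0 then b else c]).

Definition vertex3 (a b c : bool) : vertex :=
  [ffun i : 'I_3 => if i == 0 then a else if i == 1 then b else c].

Lemma edge3K (e : edge) : edge3 e.1 (e.2 0) (e.2 1) = e.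
Proof.
case: e => i c; congr (_, _); apply/ffunP; apply: ord2P; by rewrite ffunE.
Qed.

Lemma vertex3K (n : vertex) : vertex3 (n 0) (n 1) (n 2) = n.
Proof. by apply/ffunP; apply: ord3P; rewrite ffunE. Qed.

Lemma sum_edge (V : nmodType) (P : pred edge) (F : edge -> V) :
  \sum_(e | P e) F e = \sum_(i < 3) \sum_(b : bool) \sum_(c : bool)
    if P (edge3 i b c) then F (edge3 i b c) else 0.
Proof.
rewrite big_mkcond.
under [RHS]eq_bigr do rewrite pair_bigA.
rewrite pair_bigA.
rewrite (reindex (fun p : 'I_3 * (bool * bool) => edge3 p.1 p.2.1 p.2.2)) //=.
apply: onW_bij; exists (fun e : edge => (e.1, (e.2 0, e.2 1))) => [[i [b c]]|e] /=.
  by rewrite !ffunE.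
exact: edge3K.
Qed.

Lemma sum_vertex (V : nmodType) (P : pred vertex) (F : vertex -> V) :
  \sum_(n | P n) F n = \sum_(a : bool) \sum_(b : bool) \sum_(c : bool)
    if P (vertex3 a b c) then F (vertex3 a b c) else 0.
Proof.
rewrite big_mkcond.
under [RHS]eq_bigr do rewrite pair_bigA.
rewrite pair_bigA.
rewrite (reindex (fun p : bool * (bool * bool) => vertex3 p.1 p.2.1 p.2.2)) //=.
apply: onW_bij; exists (fun n : vertex => (n 0, (n 1, n 2))) => [[a [b c]]|n] /=.
  by rewrite !ffunE.
exact: vertex3K.
Qed.

Lemma sum_face (V : nmodType) (F : face -> V) :
  \sum_f F f = \sum_(i < 3) (F (i, true) + F (i, false)).
Proof.
transitivity (\sum_(i < 3) \sum_(b : bool) F (i, b)).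
  by rewrite pair_bigA; apply: eq_bigr => -[].
by apply: eq_bigr => i _; rewrite big_bool.
Qed.

Lemma vertex_of_edge3 n :
  ((forall b c, vertex_of_edge (edge3 0 b c) n = (n 1 == b) && (n 2 == c)) *
   (forall b c, vertex_of_edge (edge3 1 b c) n = (n 0 == b) && (n 2 == c)) *
   (forall b c, vertex_of_edge (edge3 2 b c) n = (n 0 == b) && (n 1 == c)))%type.
Proof.
(do !split) => b c; apply/forallP/andP => [H|[H0 H1]].
all: try (by have := (H 0, H 1); rewrite /= !ffunE !lift3E => -[]).
all: by apply: ord2P; rewrite /= ffunE lift3E.
Qed.

Section Cube.
Variables (R : realType) (T : cube R).
Local Notation q := (axis T).
Local Notation s := (orientation T).

(** On the four edges of a face the conormal is the third axis with sign plus on the side [true] and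
    minus on the side [false]. The summand [G] stays abstract because both the conormals and their
    cross products are summed. *)
Lemma sum_boundary (V : nmodType) (G : edge -> 'rV[R]_3 -> V) b :
  ((\sum_(e | edge_of_face (0, b) e) G e (conormal T (0, b) e) =
     (G (edge3 1 b true) (q 2) + G (edge3 1 b false) (- q 2) +
     (G (edge3 2 b true) (q 1) + G (edge3 2 b false) (- q 1)))%R) *
   (\sum_(e | edge_of_face (1, b) e) G e (conormal T (1, b) e) =
     (G (edge3 0 b true) (q 2) + G (edge3 0 b false) (- q 2) +
     (G (edge3 2 true b) (q 0) + G (edge3 2 false b) (- q 0)))%R) *
   (\sum_(e | edge_of_face (2, b) e) G e (conormal T (2, b) e) =
     (G (edge3 0 true b) (q 1) + G (edge3 0 false b) (- q 1) +
     (G (edge3 1 true b) (q 0) + G (edge3 1 false b) (- q 0)))%R))%type.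
Proof.
rewrite !sum_edge !sum_ord3 !big_bool /edge_of_face /conormal /outer_normal /=.
rewrite !unlift3E !rev_ord2E !lift3E !ffunE /= /sgn !scaleN1r !scale1r.
by case: b; rewrite /= ?addr0 ?add0r.
Qed.

Lemma dot_sum_outer_normal (p : face -> R) i :
  dot (\sum_f p f *: outer_normal T f) (q i) = p (i, true) - p (i, false).
Proof.
rewrite sum_face sum_ord3 /outer_normal /= !dotDl !dotZl !dot_axis.
by elim/ord3P: i => /=; ring.
Qed.

Lemma dot_sum_conormal (x : edge -> R) b :
  ((dot (\sum_(e | edge_of_face (0, b) e) x e *: conormal T (0, b) e) (q 1) =
     x (edge3 2 b true) - x (edge3 2 b false)) *
   (dot (\sum_(e | edge_of_face (0, b) e) x e *: conormal T (0, b) e) (q 2) =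
     x (edge3 1 b true) - x (edge3 1 b false)) *
   (dot (\sum_(e | edge_of_face (1, b) e) x e *: conormal T (1, b) e) (q 0) =
     x (edge3 2 true b) - x (edge3 2 false b)) *
   (dot (\sum_(e | edge_of_face (1, b) e) x e *: conormal T (1, b) e) (q 2) =
     x (edge3 0 b true) - x (edge3 0 b false)) *
   (dot (\sum_(e | edge_of_face (2, b) e) x e *: conormal T (2, b) e) (q 0) =
     x (edge3 1 true b) - x (edge3 1 false b)) *
   (dot (\sum_(e | edge_of_face (2, b) e) x e *: conormal T (2, b) e) (q 1) =
     x (edge3 0 true b) - x (edge3 0 false b)))%type.
Proof.
rewrite !(sum_boundary (fun e v => x e *: v)).
by do !split; rewrite !dotDl !dotZl !dotNl !dot_axis /=; ring.
Qed.

(** Each term contains a triple product of distinct axes, which is s or -s by cyclic order. The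
    results are s times the components of a discrete curl, such as the difference of x_2 in
    direction 1 minus that of x_1 in direction 2. *)
Lemma sum_circulation (x : edge -> R) b :
  ((\sum_(e | edge_of_face (0, b) e)
      x e * dot (q e.1) (cross (q 0) (conormal T (0, b) e)) =
     (s * (x (edge3 2 b true) - x (edge3 2 b false) -
           (x (edge3 1 b true) - x (edge3 1 b false))))%R) *
   (\sum_(e | edge_of_face (1, b) e)
      x e * dot (q e.1) (cross (q 1) (conormal T (1, b) e)) =
     (s * (x (edge3 0 b true) - x (edge3 0 b false) -
           (x (edge3 2 true b) - x (edge3 2 false b))))%R) *
   (\sum_(e | edge_of_face (2, b) e)
      x e * dot (q e.1) (cross (q 2) (conormal T (2, b) e)) =
     (s * (x (edge3 1 true b) - x (edge3 1 false b) -
           (x (edge3 0 true b) - x (edge3 0 false b))))%R))%type.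
Proof.
have crossN u v w : dot u (cross v (- w)) = - dot u (cross v w) :> R.
  by rewrite !dotE !crossE !mxE; ring.
have crossC u v w : dot u (cross v w) = - dot u (cross w v) :> R.
  by rewrite !dotE !crossE; ring.
rewrite !(sum_boundary (fun e v => x e * dot (q e.1) (cross (q _) v))) /= !crossN.
rewrite (crossC _ (q 0) (q 2)) (crossC _ (q 2) (q 1)) (crossC _ (q 1) (q 0)).
by do !split; rewrite !cross_axis !dotZr !dot_axis /=; ring.
Qed.

(** Here [d i j] is the difference in direction i of the j-th component of the face values, so S is
    again a discrete curl up to the orientation. *)
Lemma dot_sum_cross_outer_normal (b : face -> 'rV[R]_3) :
  let d i j := dot (b (i, true)) (q j) - dot (b (i, false)) (q j) in
  let S := \sum_f cross (outer_normal T f) (b f) in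
  [/\ dot S (q 0) = s * (d 1 2 - d 2 1), dot S (q 1) = s * (d 2 0 - d 0 2) &
      dot S (q 2) = s * (d 0 1 - d 1 0)].
Proof.
have E i j c v : dot (cross (outer_normal T (i, c)) v) (q j) =
    sgn R c * dot v (cross (q j) (q i)).
  by rewrite /outer_normal crossZl dotZl !dotE !crossE; ring.
have cross_ii i v : dot v (cross (q i) (q i)) = 0 by rewrite !dotE !crossE; ring.
have crossC v i j : dot v (cross (q i) (q j)) = - dot v (cross (q j) (q i)).
  by rewrite !dotE !crossE; ring.
rewrite /= sum_face sum_ord3 !dotDl !E !cross_ii.
rewrite !(crossC _ 0 2) !(crossC _ 2 1) !(crossC _ 1 0).
by rewrite !cross_axis !dotZr /sgn; split; ring.
Qed.

Lemma sum_endpoints (r : vertex -> R) b c :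
  ((\sum_(n | vertex_of_edge (edge3 0 b c) n) r n * sgn R (n 0) =
     (r (vertex3 true b c) - r (vertex3 false b c))%R) *
   (\sum_(n | vertex_of_edge (edge3 1 b c) n) r n * sgn R (n 1) =
     (r (vertex3 b true c) - r (vertex3 b false c))%R) *
   (\sum_(n | vertex_of_edge (edge3 2 b c) n) r n * sgn R (n 2) =
     (r (vertex3 b c true) - r (vertex3 b c false))%R))%type.
Proof.
rewrite !sum_vertex !big_bool !vertex_of_edge3 !ffunE /= /sgn.
by case: b; case: c; do !split; rewrite /=; ring.
Qed.

Lemma sum_flux (y : face -> R) : \sum_f y f * sgn R f.2 =
  y (0, true) - y (0, false) + (y (1, true) - y (1, false)) +
  (y (2, true) - y (2, false)).
Proof. by rewrite sum_face sum_ord3 /sgn /= !mulr1 !mulrN1. Qed.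

End Cube.
End Enumeration.

(** * Kernels, preimages and exactness at each space *)

Section Exactness.
Local Open Scope ring_scope.
Import Order.TTheory GRing.Theory Num.Theory.
Variables (R : realType) (T : cube R) (D : directions T).
Local Notation h := (side T).
Local Notation q := (axis T).
Local Notation s := (orientation T).

Lemma invr_side_eq0 (a : R) : h^-1 * a = 0 -> a = 0.
Proof.
by move=> /eqP; rewrite mulf_eq0 invr_eq0 (negbTE (side_neq0 T)) => /eqP.
Qed.

Lemma orientation_eq0 (a : R) : s * a = 0 -> a = 0.
Proof. by move=> sa; rewrite -(mul1r a) -(orientation_sqr T) -mulrA sa mulr0. Qed.

Lemma dot_axis_congr i (u v : 'rV[R]_3) : u = v -> dot u (q i) = dot v (q i).
Proof. by move=> ->. Qed.

Lemma scale_axis_eq0 i (a : R) : a *: q i = 0 -> a = 0.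
Proof. by move=> /(dot_axis_congr i); rewrite dotZl dot_axis eqxx mulr1 dot0l. Qed.

(** The components of the gradient are differences between opposite faces, between parallel edges of
    a common face, and between the ends of an edge. If they vanish, a value can be carried to the
    position [false] one coordinate at a time. *)
Lemma weak_grad0P c p x r : weak_grad D 0 (mk1 c p x r) = 0 <->
  [/\ forall i b, p (i, b) = p (i, false),
    forall i b c, x (edge3 i b c) = x (edge3 i false false) &
    forall a b c, r (vertex3 a b c) = r (vertex3 false false false)].
Proof.
rewrite weak_gradE -mk2_0; split=> [/mk2_inj[HA HB HX]|[Hp Hx Hr]].
- have Hp i : p (i, true) = p (i, false).
    move/(dot_axis_congr i): HA; rewrite dotZl dot_sum_outer_normal dot0l.
    by move=> /invr_side_eq0/subr0_eq.
  have Hx f i : dot (\sum_(e | edge_of_face f e) x e *: conormal T f e) (q i) = 0.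
    by move/(dot_axis_congr i): (HB f); rewrite dotZl dot0l => /invr_side_eq0.
  have Hr e : \sum_(n | vertex_of_edge e n) r n * sgn R (n e.1) = 0.
    by move: (HX e) => /scale_axis_eq0/invr_side_eq0.
  split=> [i []//|i b d|a b d].
  + move: i; apply: ord3P.
    * have := Hx (1, b) 2; have := Hx (2, false) 1; rewrite !dot_sum_conormal.
      by case: b; case: d; move=> /subr0_eq H1 /subr0_eq H2; rewrite ?H2 ?H1.
    * have := Hx (0, b) 2; have := Hx (2, false) 0; rewrite !dot_sum_conormal.
      by case: b; case: d; move=> /subr0_eq H1 /subr0_eq H2; rewrite ?H2 ?H1.
    * have := Hx (0, b) 1; have := Hx (1, false) 0; rewrite !dot_sum_conormal.
      by case: b; case: d; move=> /subr0_eq H1 /subr0_eq H2; rewrite ?H2 ?H1.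
  + have := Hr (edge3 0 b d); have := Hr (edge3 1 false d).
    have := Hr (edge3 2 false false); rewrite !sum_endpoints.
    move=> /subr0_eq H1 /subr0_eq H2 /subr0_eq H3.
    by case: a; rewrite ?H3; case: b {H3}; rewrite ?H2; case: d {H2}; rewrite ?H1.
- congr mk2.
  + apply: (@axis_inj _ T) => i.
    by rewrite dotZl dot_sum_outer_normal dot0l Hp subrr mulr0.
  + apply/funext => -[i b]; apply: (@axis_inj _ T) => j; rewrite dotZl dot0l.
    apply/eqP; rewrite mulf_eq0; apply/orP; right; apply/eqP.
    (* The normal component is 0 by tangency of the conormals; the other two are differences of
       equal edge values. *)
    have [->|] := eqVneq j i.
      rewrite dot_suml big1 // => e _.
      by rewrite dotZl (conormal_tangent T (i, b)) mulr0.
    by elim/ord3P: i; elim/ord3P: j => // _; rewrite dot_sum_conormal 2!Hx subrr.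
  + apply/funext => e; rewrite -(edge3K e); move: (e.1) (e.2 0) (e.2 1) => i b d.
    rewrite (_ : \sum_(n | _) _ = 0) ?mulr0 ?scale0r //.
    by elim/ord3P: i; rewrite sum_endpoints 2!Hr subrr.
Qed.

Lemma range_inclusion_w :
  range (inclusion_w R) = kernel_on (V1 R 0) (weak_grad D 0).
Proof.
apply/seteqP; split=> [_ [alpha _ <-]|_ [/V1P[c [p [x [r ->]]]]]].
  split; first by apply/V1P; do 4!eexists.
  by apply/weak_grad0P; split.
move=> /weak_grad0P[Hp Hx Hr].
exists (\row_(i < 8) nth 0 [:: c; p (0, false); p (1, false); p (2, false);
   x (edge3 0 false false); x (edge3 1 false false); x (edge3 2 false false);
   r (vertex3 false false false)] i) => //.
congr (_, _, _, _); first by rewrite mxE.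
- apply/ffunP => -[i b]; rewrite !ffunE mxE inordK /=; last by case: i => -[|[|[]]].
  by rewrite Hp; elim/ord3P: i.
- apply/ffunP => e; rewrite !ffunE mxE -(edge3K e).
  move: (e.1) (e.2 0) (e.2 1) => i b d; rewrite inordK /=; last by case: i => -[|[|[]]].
  by rewrite Hx; elim/ord3P: i.
- apply/ffunP => n; rewrite !ffunE mxE -(vertex3K n).
  by rewrite Hr inordK.
Qed.

Lemma weak_curl0P a b x : weak_curl D 0 (mk2 a b (fun e => x e *: q e.1)) = 0 <->
  \sum_f cross (outer_normal T f) (b f) = 0 /\
  forall f, \sum_(e | edge_of_face f e)
    x e * dot (q e.1) (cross (q f.1) (conormal T f e)) = 0.
Proof.
rewrite weak_curlE -mk3_0; split=> [/mk3_inj[HA HY]|[-> HY]].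
  split=> [|f]; last by move: (HY f) => /scale_axis_eq0/invr_side_eq0.
  apply: (@axis_inj _ T) => i; move/(dot_axis_congr i): HA.
  by rewrite dotZl !dot0l => /invr_side_eq0.
rewrite scaler0; congr mk3; apply/funext => f.
by rewrite HY mulr0 scale0r.
Qed.

Lemma range_weak_grad :
  [set weak_grad D 0 v | v in V1 R 0] = kernel_on (V2 D 0) (weak_curl D 0).
Proof.
apply/seteqP; split=> [_ [_ /V1P[c [p [x [r ->]]]] <-]|_ [/V2P[a [b [x [-> b0]]]]]].
  rewrite weak_gradE; split.
    apply/V2P; do 3!eexists; split=> // f.
    by rewrite dotZl dot_suml big1 ?mulr0 // => e _; rewrite dotZl conormal_tangent mulr0.
  (* Both parts vanish by the symmetry of mixed second differences: of four parallel edge values for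
     the volume part, of the four vertex values of a face for the face part. *)
  apply/weak_curl0P; split=> [|[i b]].
    apply: (@axis_inj _ T).
    have [H0 H1 H2] := dot_sum_cross_outer_normal T (fun f =>
       h^-1 *: \sum_(e | edge_of_face f e) x e *: conormal T f e).
    apply: ord3P; rewrite dot0l ?H0 ?H1 ?H2 !dotZl !dot_sum_conormal; ring.
  move: i; apply: ord3P; rewrite sum_circulation /= !sum_endpoints; ring.
move=> /weak_curl0P[HA HY].
have [] := dot_sum_cross_outer_normal T b; rewrite HA !dot0l.
move=> /esym/orientation_eq0 e0 /esym/orientation_eq0 e1 /esym/orientation_eq0 e2.
have c0 c : x (edge3 2 c true) - x (edge3 2 c false) -
           (x (edge3 1 c true) - x (edge3 1 c false)) = 0.
  by have := HY (0, c); rewrite sum_circulation => /orientation_eq0.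
have c1 c : x (edge3 0 c true) - x (edge3 0 c false) -
           (x (edge3 2 true c) - x (edge3 2 false c)) = 0.
  by have := HY (1, c); rewrite sum_circulation => /orientation_eq0.
have c2 c : x (edge3 1 true c) - x (edge3 1 false c) -
           (x (edge3 0 true c) - x (edge3 0 false c)) = 0.
  by have := HY (2, c); rewrite sum_circulation => /orientation_eq0.
pose bf i c j : R := dot (b (i, c)) (q j).
(* Only the difference between opposite faces matters; it must be h times the component of a. *)
pose p (f : face) := if f.2 then h * dot a (q f.1) else 0.
(* On the square with coordinates i, j: first along i at j = 0, then along j. *)
pose x' (e : edge) :=
  let i := lift e.1 (0 : 'I_2) in let j := lift e.1 (1 : 'I_2) in
  h * ((if e.2 0 then bf j false i else 0) +
       (if e.2 1 then bf i (e.2 0) j else 0)).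
(* The potential at n sums the edge values along the path from the corner in directions 0, 1, 2, in
   this order. *)
pose r (n : vertex) := h * ((if n 0 then x (edge3 0 false false) else 0) +
  (if n 1 then x (edge3 1 (n 0) false) else 0) +
  (if n 2 then x (edge3 2 (n 0) (n 1)) else 0)).
exists (mk1 0 p x' r); first by apply/V1P; do 4!eexists.
have hK u : h^-1 * (h * u) = u by rewrite mulKf // side_neq0.
rewrite weak_gradE; congr mk2.
- apply: (@axis_inj _ T) => i.
  by rewrite dotZl dot_sum_outer_normal /p /= subr0 hK.
- apply/funext => -[i c]; apply: (@axis_inj _ T) => j; rewrite dotZl.
  have [->|] := eqVneq j i.
    rewrite (b0 (i, c)) dot_suml big1 ?mulr0 // => e _.
    by rewrite dotZl (conormal_tangent T (i, c)) mulr0.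
  move: e0 e1 e2; rewrite -!/(bf _ _ _) => e0 e1 e2.
  (* Differences in the second direction of a square, and those in the first direction at position
     [false], hold by construction. The side opposite to the latter follows from the vanishing
     circulation [e0], [e1] or [e2]. *)
  elim/ord3P: i; elim/ord3P: j => // _; rewrite dot_sum_conormal /x' /= !ffunE !lift3E /=.
  1-6: rewrite -mulrBr hK; case: c => /=; lra.
- apply/funext => e; congr (_ *: _); rewrite -(edge3K e).
  move: (e.1) (e.2 0) (e.2 1) => i b' d'.
  (* Edges on the chosen paths have the right difference by construction; the others are reached
     through the circulations on the six faces, instantiated here for [lra]. *)
  have := (c0 true, c0 false, c1 true, c1 false, c2 true, c2 false).
  case; case; case; case; case=> {}c0 c0' {}c1 c1' {}c2 c2'.
  elim/ord3P: i; rewrite sum_endpoints /r /= !ffunE /= -mulrBr hK.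
  all: by case: b'; case: d' => /=; lra.
Qed.

Lemma range_weak_curl :
  [set weak_curl D 0 u | u in V2 D 0] = kernel_on (V3 D 0) (weak_div T 0).
Proof.
apply/seteqP; split=> [_ [_ /V2P[a [b [x [-> b0]]]] <-]|_ [/V3P[a [y ->]]]].
  rewrite weak_curlE; split; first by apply/V3P; do 2!eexists.
  (* Each edge value occurs on the two faces containing the edge, with opposite signs in the total
     flux. *)
  rewrite weak_divE sum_flux /= !sum_circulation -[RHS](mpolyC0 3 R).
  by congr mpolyC; ring.
rewrite weak_divE -[RHS](mpolyC0 3 R) => /eqP.
rewrite mpolyC_eq sum_flux => /eqP/invr_side_eq0 y0.
(* Among the differences of distinct indices only those of the component i + 1 in direction i are
   nonzero, and each enters just the component i + 2 of the volume curl. The factors s and h cancel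
   the orientation and 1/h. *)
pose b (f : face) : 'rV[R]_3 :=
  if f.2 then (s * (h * dot a (q (f.1 + 2)))) *: q (f.1 + 1) else 0.
(* Directions 1 and 0 account for the faces normal to 0 and 1; the remaining
   freedom is used for the face (2, false), and (2, true) follows from y0. *)
pose x (e : edge) : R := s * (h *
  (if e.1 == 0 then (if e.2 1 then y (1, e.2 0) else 0)
   else if e.1 == 1 then (if e.2 0 then y (2, false) else 0) -
      (if e.2 1 then y (0, e.2 0) else 0)
   else 0)).
exists (mk2 a b (fun e => x e *: q e.1)).
  apply/V2P; do 3!eexists; split=> // -[i c]; rewrite /b /=.
  case: c; rewrite ?dot0l // dotZl dot_axis.
  by elim/ord3P: i; rewrite mulr0.
have hK u : h^-1 * (h * u) = u by rewrite mulKf // side_neq0.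
have sK u : s * (s * u) = u by rewrite mulrA orientation_sqr mul1r.
rewrite weak_curlE; congr mk3.
  apply: (@axis_inj _ T).
  have [H0 H1 H2] := dot_sum_cross_outer_normal T b.
  apply: ord3P; rewrite dotZl ?H0 ?H1 ?H2 /b /= !dot0l !dotZl !dot_axis /=.
  1-3: rewrite ?mulr0 ?mulr1 ?subr0 sK hK.
  1-3: by congr (dot _ (q _)); apply/val_inj.
apply/funext => -[i c]; congr (_ *: _).
elim/ord3P: i; rewrite sum_circulation /x /= !ffunE /= -?mulrBr sK hK.
all: by case: c => /=; lra.
Qed.

Lemma range_weak_div : [set weak_div T 0 w | w in V3 D 0] = V4 R 0.
Proof.
apply/seteqP; split=> [_ [_ /V3P[a [y ->]] <-]|_ /poly_space0P[d ->]].
  by rewrite weak_divE; apply/poly_space0P; eexists.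
(* A flux through a single face already produces any prescribed constant divergence. *)
pose y (f : face) := if f == (0, true) then h * d else 0.
exists (mk3 0 (fun f => y f *: q f.1)); first by apply/V3P; do 2!eexists.
by rewrite weak_divE sum_flux /y /= !subr0 !addr0 mulKf // side_neq0.
Qed.

End Exactness.

Theorem theorem6p2 (R : realType) (T : cube R) (D : directions T) :
  [/\ range (inclusion_w R) = kernel_on (V1 R 0) (weak_grad D 0),
      [set weak_grad D 0 v | v in V1 R 0] =
        kernel_on (V2 D 0) (weak_curl D 0),
      [set weak_curl D 0 u | u in V2 D 0] =
        kernel_on (V3 D 0) (weak_div T 0) &
      [set weak_div T 0 w | w in V3 D 0] = V4 R 0].
Proof.
split.
- exact: range_inclusion_w.
- exact: range_weak_grad.
- exact: range_weak_curl.
- exact: range_weak_div.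
Qed.
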